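(* Consider the plant, reference model, offline data, online sampling times $0=t_0<t_1<\dots<t_M<t_{M+1}=\infty$ and signals $\mathcal{U}(t),\mathcal{D}(t)$ described in the context. Let $\Gamma\in\mathbb{R}^{2n\times 2n}$ be symmetric positive definite. Let the initial conditions $x(0)\in\mathbb{R}^n$, $x_{\mathrm m}(0)\in\mathbb{R}^n$ and $\Psi(0)\in\mathbb{R}^{2n\times(n+p)}$ be arbitrary, and suppose that online (for $t\ge 0$) the plant is driven by the input $$u(t)=\mathcal{U}(t)\Psi(t)\begin{bmatrix}x(t)\\ r(t)\end{bmatrix},$$ where $\Psi$ is updated by the adaptive law $$\dot\Psi(t)=-\Gamma\left(\mathcal{D}(t)\Psi(t)-R_{\mathrm m}\right).$$ If $$\operatorname{im}R_{\mathrm m}\subseteq\operatorname{im}\mathcal{D}(t_M),$$ then the control gains $\begin{bmatrix}\hat K(t)&\hat L(t)\end{bmatrix}:=\mathcal{U}(t)\Psi(t)$, with $\hat K(t)\in\mathbb{R}^{m\times n}$ and $\hat L(t)\in\mathbb{R}^{m\times p}$, satisfy $$\lim_{t\to\infty}\begin{bmatrix}A_{\mathrm m}-A_{\mathrm s}-B_{\mathrm s}\hat K(t)& B_{\mathrm m}-B_{\mathrm s}\hat L(t)\end{bmatrix}=\bar W_M\,\mathcal{D}(t_M)^\dagger R_{\mathrm m}.$$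
   Context: Plant: $\dot x(t)=A_{\mathrm s}x(t)+B_{\mathrm s}u(t)+E_{\mathrm s}w(t)$ with state $x\in\mathbb{R}^n$, input $u\in\mathbb{R}^m$, bounded process noise $w\in\mathbb{R}^q$, and matrices $A_{\mathrm s}\in\mathbb{R}^{n\times n}$, $B_{\mathrm s}\in\mathbb{R}^{n\times m}$, $E_{\mathrm s}\in\mathbb{R}^{n\times q}$. Reference model: $\dot x_{\mathrm m}(t)=A_{\mathrm m}x_{\mathrm m}(t)+B_{\mathrm m}r(t)$ with $x_{\mathrm m}\in\mathbb{R}^n$, reference input $r\in\mathbb{R}^p$, $m\ge p$, $A_{\mathrm m}\in\mathbb{R}^{n\times n}$ Hurwitz (all eigenvalues have negative real part), $B_{\mathrm m}\in\mathbb{R}^{n\times p}$, and $(A_{\mathrm m},B_{\mathrm m})$ controllable. Put $R_{\mathrm m}=\begin{bmatrix}I&0\\ A_{\mathrm m}&B_{\mathrm m}\end{bmatrix}\in\mathbb{R}^{2n\times(n+p)}$. Filters: fix $\rho>0$. For a trajectory $(u,x,w)$ of the plant starting at time $0$, define $x^{\mathrm f},u^{\mathrm f},w^{\mathrm f}$ by $\dot x^{\mathrm f}=-\rho x^{\mathrm f}+x$, $\dot u^{\mathrm f}=-\rho u^{\mathrm f}+u$, $\dot w^{\mathrm f}=-\rho w^{\mathrm f}+w$ with zero initial values, and $x^{\mathrm{df}}(t)=x(t)-e^{-\rho t}x(0)-\rho x^{\mathrm f}(t)$ (equivalently $\dot x^{\mathrm{df}}=-\rho x^{\mathrm{df}}+\dot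 x$, $x^{\mathrm{df}}(0)=0$). Offline data: from a plant trajectory on $[0,\mathcal{T}]$ and times $0<\tau_1<\dots<\tau_N\le\mathcal{T}$, form the matrices $X^{\mathrm D}=[x^{\mathrm{df}}(\tau_1)\cdots x^{\mathrm{df}}(\tau_N)]$, $X=[x^{\mathrm f}(\tau_1)\cdots x^{\mathrm f}(\tau_N)]$, $U=[u^{\mathrm f}(\tau_1)\cdots u^{\mathrm f}(\tau_N)]$, $W=[w^{\mathrm f}(\tau_1)\cdots w^{\mathrm f}(\tau_N)]$. Online data: let $M\ge 1$ be an integer. From the online (closed-loop) plant trajectory on $[0,\infty)$, with its own clock and filters, and for $j\in\{1,\dots,M\}$, let $X_j^{\mathrm D}=[X^{\mathrm D}\ x^{\mathrm{df}}(t_1)\cdots x^{\mathrm{df}}(t_j)]$, $X_j=[X\ x^{\mathrm f}(t_1)\cdots x^{\mathrm f}(t_j)]$, $U_j=[U\ u^{\mathrm f}(t_1)\cdots u^{\mathrm f}(t_j)]$, $W_j=[W\ w^{\mathrm f}(t_1)\cdots w^{\mathrm f}(t_j)]\in\mathbb{R}^{q\times(N+j)}$. Piecewise constant signals: for $t\in[0,t_1)$, $\mathcal{U}(t)=\frac1N U\begin{bmatrix}X\\ X^{\mathrm D}\end{bmatrix}^\top$ and $\mathcal{D}(t)=\frac1N\begin{bmatrix}X\\ X^{\mathrm D}\end{bmatrix}\begin{bmatrix}X\\ X^{\mathrm D}\end{bmatrix}^\top$; for $t\in[t_j,t_{j+1})$, $j\in\{1,\dots,M\}$, $$\mathcal{U}(t)=\tfrac{N+j-1}{N+j}\mathcal{U}(t_{j-1})+\tfrac1{N+j}u^{\mathrm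 f}(t_j)\begin{bmatrix}x^{\mathrm f}(t_j)\\ x^{\mathrm{df}}(t_j)\end{bmatrix}^\top,\qquad \mathcal{D}(t)=\tfrac{N+j-1}{N+j}\mathcal{D}(t_{j-1})+\tfrac1{N+j}\begin{bmatrix}x^{\mathrm f}(t_j)\\ x^{\mathrm{df}}(t_j)\end{bmatrix}\begin{bmatrix}x^{\mathrm f}(t_j)\\ x^{\mathrm{df}}(t_j)\end{bmatrix}^\top.$$ Finally $\bar W_M=\frac1{N+M}E_{\mathrm s}W_M\begin{bmatrix}X_M\\ X_M^{\mathrm D}\end{bmatrix}^\top$, and $\dagger$ denotes the Moore–Penrose pseudo-inverse. *)

(* Defs.v *)
From HB Require Import structures.
From mathcomp Require Import all_boot all_order all_algebra.
From mathcomp Require Import complex.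
From mathcomp Require Import all_classical all_reals all_analysis.

Set Implicit Arguments.
Unset Strict Implicit.
Unset Printing Implicit Defensive.

Import Order.TTheory GRing.Theory Num.Theory.
Import numFieldNormedType.Exports.

Local Open Scope classical_set_scope.
Local Open Scope ring_scope.

(* [ode_on I z f] says that z' = f on the time interval I, where I is [0, T]
   or [0, +oo[.  Since f may jump (sampled gains, discontinuous noise),
   solutions are taken in the sense of Caratheodory: f is integrable on every
   [0, t] with t in I, and z is z(0) plus the integral of f, entrywise.  Here
   [f] is the right-hand side evaluated along the trajectory. *)
Definition ode_on (R : realType) (I : set R) (a b : nat)
    (z f : R -> 'M[R]_(a, b)) : Prop :=
  forall t, I t -> forall (i : 'I_a) (j : 'I_b),
    lebesgue_measure.-integrable `[0, t] (fun s => (f s i j)%:E) /\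
    z t i j = z 0 i j + \int[lebesgue_measure]_(s in `[0, t]) f s i j.

Definition plant_trajectory (R : realType) (I : set R) (n m q : nat)
    (As : 'M[R]_n) (Bs : 'M[R]_(n, m)) (Es : 'M[R]_(n, q))
    (x : R -> 'cV[R]_n) (u : R -> 'cV[R]_m) (w : R -> 'cV[R]_q) : Prop :=
  ode_on I x (fun t => As *m x t + Bs *m u t + Es *m w t) /\
  [bounded w t | t in I].

Definition filtered (R : realType) (I : set R) (k : nat) (rho : R)
    (z zf : R -> 'cV[R]_k) : Prop :=
  zf 0 = 0 /\ ode_on I zf (fun t => - rho *: zf t + z t).

Definition xdf (R : realType) (n : nat) (rho : R) (x xf : R -> 'cV[R]_n)
    (t : R) : 'cV[R]_n :=
  x t - expR (- rho * t) *: x 0 - rho *: xf t.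

Definition samples (R : realType) (k N : nat) (z : R -> 'cV[R]_k)
    (tau : 'I_N -> R) : 'M[R]_(k, N) :=
  \matrix_(i < k, l < N) z (tau l) i 0.

Definition hurwitz (R : realType) (n : nat) (A : 'M[R]_n) : Prop :=
  forall z : R[i], eigenvalue (map_mx (real_complex R) A) z -> complex.Re z < 0.

Definition controllable (R : realType) (n p : nat) (A : 'M[R]_n)
    (B : 'M[R]_(n, p)) : Prop :=
  forall x0 x1 : 'cV[R]_n, exists T : R, 0 < T /\
    exists (x : R -> 'cV[R]_n) (u : R -> 'cV[R]_p),
      [/\ ode_on `[0, T] x (fun t => A *m x t + B *m u t),
          x 0 = x0 & x T = x1].

Definition sym_posdef (R : realType) (k : nat) (G : 'M[R]_k) : Prop :=
  G^T = G /\ forall v : 'cV[R]_k, v != 0 -> 0 < (v^T *m G *m v) 0 0.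

Definition ref_mx (R : realType) (n p : nat) (Am : 'M[R]_n)
    (Bm : 'M[R]_(n, p)) : 'M[R]_(n + n, n + p) :=
  block_mx 1%:M 0 Am Bm.

Definition im_mx (R : realType) (a b : nat) (A : 'M[R]_(a, b)) :
    set 'cV[R]_a :=
  range (fun v : 'cV[R]_b => A *m v).

(* [F] is the piecewise constant signal equal to S0 / N on [0, ts 1[ and, on
   [ts j, ts (j+1)[ for 1 <= j <= M, to the running average of F (ts (j-1))
   and S j.  The values of ts beyond M are never used: the last interval is
   [ts M, +oo[. *)
Definition piecewise_average (R : realType) (a b N M : nat) (ts : nat -> R)
    (S0 : 'M[R]_(a, b)) (S : nat -> 'M[R]_(a, b)) (F : R -> 'M[R]_(a, b)) :
    Prop :=
  (forall t, 0 <= t < ts 1%N -> F t = N%:R^-1 *: S0) /\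
  (forall j t, (1 <= j <= M)%N -> ts j <= t -> ((j < M)%N -> t < ts j.+1) ->
    F t = ((N + j - 1)%:R / (N + j)%:R) *: F (ts (j - 1)%N) +
          (N + j)%:R^-1 *: S j).

Definition is_moore_penrose (R : realType) (a b : nat) (A : 'M[R]_(a, b))
    (P : 'M[R]_(b, a)) : Prop :=
  [/\ A *m P *m A = A, P *m A *m P = P,
      (A *m P)^T = A *m P & (P *m A)^T = P *m A].

(* MathComp's [pinvmx] is only a partial inverse, not the Moore-Penrose one. *)
Definition moore_penrose (R : realType) (a b : nat) (A : 'M[R]_(a, b)) :
    'M[R]_(b, a) :=
  xget 0 [set P | is_moore_penrose A P].

Lemma mulmx_tr_eq0 (R : realType) (a b : nat) (A : 'M[R]_(a, b)) :
  A *m A^T = 0 -> A = 0.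
Proof.
move=> A0; apply/matrixP => i j; rewrite mxE.
have /matrixP/(_ i i) := A0; rewrite !mxE => /eqP.
rewrite psumr_eq0; last by move=> k _; rewrite mxE -expr2 sqr_ge0.
by move=> /allP/(_ j (mem_index_enum j)); rewrite mxE mulf_eq0 orbb => /eqP.
Qed.

Lemma row_free_gram (R : realType) (a b : nat) (A : 'M[R]_(a, b)) :
  row_free A -> A *m A^T \in unitmx.
Proof.
move=> fA; rewrite -row_free_unit -kermx_eq0; apply/eqP.
set K := kermx _.
have K0 : K *m (A *m A^T) = 0 by exact: mulmx_ker.
have KA0 : K *m A = 0.
  by apply: mulmx_tr_eq0; rewrite trmx_mul mulmxA -(mulmxA K A) K0 mul0mx.
by apply: (row_free_inj fA); rewrite KA0 mul0mx.
Qed.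

Lemma moore_penrose_exists (R : realType) (a b : nat) (A : 'M[R]_(a, b)) :
  exists P, is_moore_penrose A P.
Proof.
have [r [C [F [CF cC fF]]]] : exists r (C : 'M[R]_(a, r)) (F : 'M[R]_(r, b)),
    [/\ A = C *m F, row_full C & row_free F].
  exists (\rank A), (col_base A), (row_base A).
  by rewrite mulmx_base col_base_full row_base_free.
have uF : F *m F^T \in unitmx by exact: row_free_gram.
have uC : C^T *m C \in unitmx.
  by rewrite -{2}[C]trmxK; apply: row_free_gram; rewrite /row_free mxrank_tr.
set G := invmx (F *m F^T); set H := invmx (C^T *m C).
have GT : G^T = G by rewrite /G trmx_inv trmx_mul trmxK.
have HT : H^T = H by rewrite /H trmx_inv trmx_mul trmxK.
pose P := F^T *m G *m (H *m C^T).
have AP : A *m P = C *m H *m C^T.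
  rewrite CF /P -!mulmxA (mulmxA F F^T) (mulmxA (F *m F^T) G).
  by rewrite mulmxV // mul1mx.
have PA : P *m A = F^T *m G *m F.
  rewrite CF /P -!mulmxA (mulmxA C^T C) (mulmxA H (C^T *m C)).
  by rewrite mulVmx // mul1mx.
exists P; split.
- by rewrite AP CF -!mulmxA (mulmxA C^T C) (mulmxA H (C^T *m C)) mulVmx // mul1mx.
- rewrite PA /P -!mulmxA (mulmxA F F^T) (mulmxA (F *m F^T) G).
  by rewrite mulmxV // mul1mx.
- by rewrite AP !trmx_mul trmxK HT mulmxA.
- by rewrite PA !trmx_mul trmxK GT mulmxA.
Qed.

Lemma moore_penroseP (R : realType) (a b : nat) (A : 'M[R]_(a, b)) :
  is_moore_penrose A (moore_penrose A).
Proof.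
by have [P AP] := moore_penrose_exists A; apply: (@xgetPex _ 0 [set P | is_moore_penrose A P]); exists P.
Qed.

Lemma moore_penrose_uniq (R : realType) (a b : nat) (A : 'M[R]_(a, b))
    (P Q : 'M[R]_(b, a)) :
  is_moore_penrose A P -> is_moore_penrose A Q -> P = Q.
Proof.
move=> [P1 P2 P3 P4] [Q1 Q2 Q3 Q4].
have APQ : A *m P = A *m Q.
  by rewrite -P3 -{1}Q1 -(mulmxA (A *m Q) A P) trmx_mul P3 Q3 mulmxA P1.
have PQA : P *m A = Q *m A.
  by rewrite -P4 -{1}Q1 -(mulmxA A Q A) mulmxA trmx_mul P4 Q4 -mulmxA
    (mulmxA A P A) P1.
by rewrite -P2 -mulmxA APQ mulmxA PQA Q2.
Qed.

(* Main.v *)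
Require Import Defs.
From HB Require Import structures.
From mathcomp Require Import all_boot all_order all_algebra.
From mathcomp Require Import complex ring lra.
From mathcomp Require Import all_classical all_reals all_analysis.

Import Order.TTheory GRing.Theory Num.Theory.
Import numFieldNormedType.Exports.

Local Open Scope classical_set_scope.
Local Open Scope ring_scope.

Set Implicit Arguments.
Unset Strict Implicit.
Unset Printing Implicit Defensive.

(** The controller knows neither [As], [Bs] nor the noise, but filtering turns
    the plant equation into exact linear relations between data.  The signal
    [x - rho xf - As xf - Bs uf - Es wf] solves [y' = - rho y], so it equals
    [expR (- rho t) x(0)], which says that [xdf = As xf + Bs uf + Es wf] at
    every time ([filtered_data]).  Sampling offline and online data gives
    [XDM = As XM + Bs UM + Es WM].

    From [ts M] on, [calD] and [calU] are the constants
    [D = (N + M)^-1 Z Z^T] and [(N + M)^-1 UM Z^T], with [Z] the stack of [XM]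
    over [XDM] ([piecewise_average_at]).  Multiplying the data relation by
    [Z^T] therefore expresses [Bs calU] through [D] and [barWM], and
    [moore_penrose_gram] gives [barWM D^+ D = barWM].  Together
    ([gain_error]) the matching error is
    [barWM D^+ R + (barWM D^+ - [-As I]) (D Psi - R)] with
    [R = ref_mx Am Bm], so that only [D Psi - R --> 0] remains.

    Write [R = D Q], which the inclusion of images permits.  Each column
    [theta] of [Psi - Q] follows [theta' = - Gamma D theta].  The form
    [W = theta^T D theta] has derivative [- 2 e^T Gamma e] with
    [e = D theta].  Even when [D] is singular, [W] and [|e|^2] bound each
    other up to constants: [W = e^T D^+ e <= K |e|^2], and
    [|e|^2 <= L W] since [D] is positive semidefinite.  Since [Gamma] is
    coercive, [W] decays exponentially, hence so does [e]
    ([gradient_flow_residual_cvg0], [adaptive_law_cvg]). *)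

(** * Linear calculus of Caratheodory solutions *)

Lemma eq_ode_on (R : realType) (I : set R) (a b : nat)
    (z z' f f' : R -> 'M[R]_(a, b)) :
  z =1 z' -> f =1 f' -> ode_on I z f -> ode_on I z' f'.
Proof. by move=> /funext -> /funext ->. Qed.

Lemma ode_onD (R : realType) (I : set R) (a b : nat)
    (z z' f f' : R -> 'M[R]_(a, b)) :
  ode_on I z f -> ode_on I z' f' ->
  ode_on I (fun t => z t + z' t) (fun t => f t + f' t).
Proof.
move=> hz hz' t It i j.
have [fi zE] := hz t It i j; have [fi' zE'] := hz' t It i j; split.
  rewrite (_ : (fun s => _) = (fun s => (f s i j)%:E + (f' s i j)%:E)%E).
    exact: integrableD.
  by apply/funext => s; rewrite mxE EFinD.
rewrite !mxE zE zE' addrACA -RintegralD//; congr (_ + _).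
by apply: eq_Rintegral => s _; rewrite mxE.
Qed.

Lemma ode_on_mulmx (R : realType) (I : set R) (a b c : nat)
    (A : 'M[R]_(c, a)) (z f : R -> 'M[R]_(a, b)) :
  ode_on I z f -> ode_on I (fun t => A *m z t) (fun t => A *m f t).
Proof.
move=> hz t It i j.
have fi k : lebesgue_measure.-integrable `[0, t]
    (EFin \o (fun s => A i k * f s k j)).
  have [+ _] := hz t It k j; move=> /(integrableZl _ (A i k)).
  by apply; exact: measurable_itv.
have sum_int (s : seq 'I_a) :
    lebesgue_measure.-integrable `[0, t]
      (EFin \o (fun u => \sum_(k <- s) A i k * f u k j)) /\
    \int[lebesgue_measure]_(u in `[0, t]) (\sum_(k <- s) A i k * f u k j) =
    \sum_(k <- s) A i k * \int[lebesgue_measure]_(u in `[0, t]) f u k j.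
  elim: s => [|k s [IHi IHe]].
    rewrite (_ : (fun u => _) = cst 0); last by apply/funext => u; rewrite big_nil.
    split; first exact: integrable0.
    by rewrite big_nil Rintegral_cst ?mul0r//; exact: measurable_itv.
  rewrite (_ : (fun u => _) = (fun u => A i k * f u k j +
     \sum_(k <- s) A i k * f u k j)); last first.
    by apply/funext => u; rewrite big_cons.
  split.
    rewrite (_ : EFin \o _ = ((EFin \o (fun u => A i k * f u k j)%R) \+
      (EFin \o (fun u => \sum_(k <- s) A i k * f u k j)%R))%E)//.
    by apply: integrableD; [exact: measurable_itv|exact: fi|].
  rewrite RintegralD// big_cons IHe RintegralZl//.
  by have [] := hz t It k j.
have [si se] := sum_int (index_enum 'I_a).
split.
  rewrite (_ : (fun s => _) = (EFin \o (fun u => \sum_k A i k * f u k j)))//.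
  by apply/funext => u; rewrite mxE.
have -> : \int[lebesgue_measure]_(u in `[0, t]) (A *m f u) i j =
    \sum_k A i k * \int[lebesgue_measure]_(u in `[0, t]) f u k j.
  by rewrite -se; apply: eq_Rintegral => u _; rewrite mxE.
rewrite !mxE -big_split/=; apply: eq_bigr => k _.
by have [_ ->] := hz t It k j; rewrite mulrDr.
Qed.

(** Solutions in the sense of Caratheodory are integrals of integrable
    functions, hence continuous even where the right-hand side jumps. *)
Lemma ode_on_continuous (R : realType) (I : set R) (a b : nat)
    (z f : R -> 'M[R]_(a, b)) (t : R) (i : 'I_a) (j : 'I_b) :
  `[0, t] `<=` I -> 0 <= t -> ode_on I z f ->
  {within `[0, t], continuous (fun s => z s i j)}.
Proof.
move=> tI t0 hz.
have It : I t by apply: tI => /=; rewrite in_itv/= t0 lexx.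
have [fi _] := hz t It i j.
have := parameterized_integral_continuous t0 fi.
move=> /(fun h s => cvgD (@cvg_cst _ (z 0 i j) _ (nbhs s) _) (h s)) h.
apply: (@subspace_eq_continuous _ _ _ _ _ _ h) => s.
move/set_mem => /= st; have [_ zE] := hz s (tI _ st) i j.
exact: esym zE.
Qed.

(** The integral equation is differentiated only at points of continuity of
    the right-hand side. *)
Lemma ode_on_derive (R : realType) (I : set R) (a b : nat)
    (z f : R -> 'M[R]_(a, b)) (s t : R) (i : 'I_a) (j : 'I_b) :
  `[0, t] `<=` I -> 0 < s < t -> ode_on I z f ->
  {for s, continuous (fun s => f s i j)} ->
  is_derive s 1 (fun s => z s i j : R) (f s i j).
Proof.
move=> tI /andP[s0 st] hz fs.
have It : I t by apply: tI => /=; rewrite in_itv/= lexx andbT ltW// (lt_trans s0).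
have [fi _] := hz t It i j.
have [/= dF F'] := continuous_FTC1_closed st fi s0 fs.
have dF' : is_derive s 1 (fun s => z 0 i j +
    \int[lebesgue_measure]_(u in `[0, s]) f u i j) (0 + f s i j).
  apply: is_deriveD; split => //.
  by rewrite -F' derive1E.
rewrite add0r in dF'.
apply: near_eq_is_derive dF'.
near=> y.
have Iy : I y.
  apply: tI => /=; rewrite in_itv/=; apply/andP; split; apply: ltW.
    by near: y; exact: lt_nbhsr.
  by near: y; exact: lt_nbhsl.
by have [_ ->] := hz y Iy i j.
Unshelve. all: by end_near. Qed.

(** * Filtered plant data *)

Lemma is_derive_expRM (R : realType) (k t : R) :
  is_derive t 1 (fun s : R => expR (k * s)) (k * expR (k * t)).
Proof.
have dk : is_derive t 1 ( *%R k : R -> R) k.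
  have := is_deriveZ k (is_derive_id t (1 : R)).
  by rewrite /GRing.scale/= mulr1.
have := is_derive1_comp (is_derive_expR (k * t)) dk.
by rewrite mulrC.
Qed.

(** Uniqueness for [z' = k z]: a continuous solution has a continuous
    right-hand side, so it is differentiable inside the interval and
    [expR (- k s) * z s] has zero derivative there. *)
Lemma ode_on_exp (R : realType) (I : set R) (a b : nat) (k t : R)
    (z : R -> 'M[R]_(a, b)) :
  `[0, t] `<=` I -> 0 <= t -> ode_on I z (fun s => k *: z s) ->
  z t = expR (k * t) *: z 0.
Proof.
move=> tI; rewrite le_eqVlt => /predU1P[<- _|t0 hz].
  by rewrite mulr0 expR0 scale1r.
apply/matrixP => i j; rewrite mxE.
pose h (s : R) : R := expR (- k * s) * z s i j.
have cz := ode_on_continuous (i := i) (j := j) tI (ltW t0) hz.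
have ch : {within `[0, t], continuous h}.
  move=> s; apply: cvgM; last exact: cz.
  apply: continuous_subspaceT => {s}; move=> s.
  apply: differentiable_continuous; apply/derivable1_diffP.
  by have [] := is_derive_expRM (- k) s.
have dh (s : R) : s \in `]0, t[ -> is_derive s 1 h 0.
  move=> st; have /= czs := within_continuous_continuous t0 cz st.
  rewrite in_itv/= in st.
  have dz : is_derive s 1 (fun s => z s i j : R) (k * z s i j).
    have := @ode_on_derive _ _ _ _ _ _ s t i j tI st hz.
    rewrite mxE; apply.
    rewrite (_ : (fun s => _) = (fun s => k * z s i j)); last first.
      by apply/funext => y; rewrite mxE.
    by apply: cvgM; [exact: cvg_cst|exact: czs].
  have := is_deriveM (is_derive_expRM (- k) s) dz.
  rewrite (_ : _ + _ = 0)// /GRing.scale/=.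
  ring.
have [c _] := @MVT _ h (fun=> 0) _ _ t0 dh ch.
rewrite mul0r => /eqP; rewrite subr_eq0 /h mulr0 expR0 mul1r => /eqP <-.
by rewrite mulrA -expRD mulNr subrr expR0 mul1r.
Qed.

(** Filtering removes the derivative of the state from the plant equation at
    the cost of the transient [expR (- rho t) *: x 0], which [xdf] subtracts. *)
Lemma filtered_data (R : realType) (I : set R) (n m q : nat)
    (As : 'M[R]_n) (Bs : 'M[R]_(n, m)) (Es : 'M[R]_(n, q)) (rho t : R)
    (x : R -> 'cV[R]_n) (u : R -> 'cV[R]_m) (w : R -> 'cV[R]_q)
    (xf : R -> 'cV[R]_n) (uf : R -> 'cV[R]_m) (wf : R -> 'cV[R]_q) :
  `[0, t] `<=` I -> 0 <= t ->
  ode_on I x (fun t => As *m x t + Bs *m u t + Es *m w t) ->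
  filtered I rho x xf -> filtered I rho u uf -> filtered I rho w wf ->
  xdf rho x xf t = As *m xf t + Bs *m uf t + Es *m wf t.
Proof.
move=> tI t0 hx [xf0 hxf] [uf0 huf] [wf0 hwf].
(* The residual without the transient: its initial value is [x 0], so it is
   the transient itself. *)
pose y s := x s + (- (rho%:M + As) *m xf s + - Bs *m uf s + - Es *m wf s).
have hy : ode_on I y (fun s => - rho *: y s).
  apply: eq_ode_on (ode_onD hx (ode_onD (ode_onD
    (ode_on_mulmx (- (rho%:M + As)) hxf) (ode_on_mulmx (- Bs) huf))
    (ode_on_mulmx (- Es) hwf))) => //= s.
  rewrite /y !mulmxDr -!scalemxAr !mulNmx !mulmxDl !mul_scalar_mx.
  apply/matrixP => i j; rewrite !mxE; ring.
have := ode_on_exp tI t0 hy.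
rewrite {2}/y xf0 uf0 wf0 !mulmx0 !addr0 /xdf => <-.
rewrite /y !mulNmx mulmxDl mul_scalar_mx.
apply/matrixP => i j; rewrite !mxE; ring.
Qed.

(** * Bounds on quadratic forms *)

(** Each [v_i v_j] is at most [|v|^2] in absolute value, so the sum of the
    absolute values of the entries of [A] is a bound; the 1 added to it makes it
    positive. *)
Lemma quad_bound (R : realType) (k : nat) (A : 'M[R]_k) :
  exists2 C, 0 < C &
    forall v : 'cV[R]_k, (v^T *m A *m v) 0 0 <= C * (v^T *m v) 0 0.
Proof.
pose C := \sum_i \sum_j `|A i j|.
have C0 : 0 <= C by apply: sumr_ge0 => i _; apply: sumr_ge0 => j _.
exists (C + 1) => [|v]; first by rewrite ltr_pwDr.
have vv : (v^T *m v) 0 0 = \sum_i v i 0 ^+ 2.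
  by rewrite mxE; apply: eq_bigr => i _; rewrite mxE expr2.
have vle i : v i 0 ^+ 2 <= (v^T *m v) 0 0.
  by rewrite vv (bigD1 i)//= lerDl sumr_ge0// => j _; rewrite sqr_ge0.
apply: (@le_trans _ _ (C * (v^T *m v) 0 0)); last first.
  by rewrite ler_wpM2r ?lerDl// vv sumr_ge0// => j _; rewrite sqr_ge0.
rewrite -mulmxA mxE /C mulr_suml ler_sum// => i _.
rewrite !mxE mulr_sumr mulr_suml ler_sum// => j _.
rewrite mulrCA; apply: (le_trans (ler_norm _)); rewrite normrM ler_wpM2l//.
rewrite ler_norml.
have := vle i; have := vle j; have := sqr_ge0 (v i 0 - v j 0).
have := sqr_ge0 (v i 0 + v j 0); rewrite !mxE; nra.
Qed.

(** Expanding [0 <= (v - s S v)^T S (v - s S v)] at [s = 1 / C], where [C]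
    bounds the form of [S], compares the linear and quadratic terms in [s]. *)
Lemma psd_image_bound (R : realType) (k : nat) (S : 'M[R]_k) :
  S^T = S -> (forall v : 'cV[R]_k, 0 <= (v^T *m S *m v) 0 0) ->
  exists2 C, 0 < C & forall v : 'cV[R]_k,
    ((S *m v)^T *m (S *m v)) 0 0 <= C * (v^T *m S *m v) 0 0.
Proof.
move=> ST S0; have [C C0 hC] := quad_bound S.
exists C => // v; set y := S *m v.
have vS : v^T *m S = y^T by rewrite /y trmx_mul ST.
have := S0 (v - C^-1 *: y); have := hC y.
set a := (y^T *m S *m y) 0 0; set b := (y^T *m y) 0 0.
set c := (v^T *m S *m v) 0 0.
have -> : ((v - C^-1 *: y)^T *m S *m (v - C^-1 *: y)) 0 0 =
    c - C^-1 * b - C^-1 * b + C^-1 * (C^-1 * a).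
  have -> : (v - C^-1 *: y)^T = v^T - C^-1 *: y^T by rewrite linearB/= linearZ.
  rewrite !mulmxBl !mulmxBr -!scalemxAl -!scalemxAr.
  rewrite vS -[y^T *m S *m v]mulmxA -/y /a /b /c vS !mxE; ring.
move=> aCb.
have : C^-1 * (C^-1 * a) <= C^-1 * b.
  by rewrite ler_pM2l ?invr_gt0// -(ler_pM2l C0) mulrA divff ?gt_eqF// mul1r.
move=> h1 h2; have : C^-1 * b <= c by lra.
by rewrite -(ler_pM2l C0) mulrA divff ?gt_eqF// mul1r.
Qed.

(** [psd_image_bound] controls [|G v|^2] by the form of [G]; bounding the
    form of [(G^-1)^T G^-1] at [G v] then recovers [|v|^2]. *)
Lemma posdef_coercive (R : realType) (k : nat) (G : 'M[R]_k) :
  sym_posdef G ->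
  exists2 c, 0 < c &
    forall v : 'cV[R]_k, c * (v^T *m v) 0 0 <= (v^T *m G *m v) 0 0.
Proof.
move=> [GT Gpos].
have G0 (v : 'cV[R]_k) : 0 <= (v^T *m G *m v) 0 0.
  by have [->|v0] := eqVneq v 0; [rewrite mulmx0 mxE|exact/ltW/Gpos].
have [C C0 hC] := psd_image_bound GT G0.
have uG : G \in unitmx.
  rewrite -row_free_unit -kermx_eq0; apply/eqP/row_matrixP => i; rewrite row0.
  apply/eqP/negPn/negP => /negP ri.
  have /Gpos : (row i (kermx G))^T != 0.
    by apply: contra_notN ri => /eqP r0; rewrite -[row _ _]trmxK r0 trmx0.
  by rewrite trmxK -row_mul mulmx_ker row0 mul0mx mxE ltxx.
have [K K0 hK] := quad_bound ((invmx G)^T *m invmx G).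
exists (K * C)^-1 => [|v]; first by rewrite invr_gt0 mulr_gt0.
rewrite -(ler_pM2l (mulr_gt0 K0 C0)) mulrA divff ?gt_eqF ?mulr_gt0// mul1r.
have := hK (G *m v).
rewrite -!mulmxA mulKmx// mulmxA -trmx_mul mulKmx// => /le_trans; apply.
by rewrite -mulrA ler_pM2l// [v^T *m _]mulmxA.
Qed.

Lemma is_derive_quad (R : realType) (k : nat) (D : 'M[R]_k)
    (z : R -> 'cV[R]_k) (dz : 'cV[R]_k) (t : R) :
  D^T = D -> (forall i, is_derive t 1 (fun s => z s i 0 : R) (dz i 0)) ->
  is_derive t 1 (fun s => ((z s)^T *m D *m z s) 0 0 : R)
    (2 * ((z t)^T *m D *m dz) 0 0).
Proof.
move=> DT dzE.
have -> : (fun s => ((z s)^T *m D *m z s) 0 0 : R) =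
    \sum_i \sum_j (fun s => z s i 0 * (D i j * z s j 0)).
  apply/funext => s; rewrite fct_sumE -mulmxA mxE; apply: eq_bigr => i _.
  by rewrite fct_sumE !mxE mulr_sumr.
have dterm i j : is_derive t 1 (fun s => z s i 0 * (D i j * z s j 0) : R)
    (z t i 0 * (D i j * dz j 0) + D i j * z t j 0 * dz i 0).
  have dZ := is_deriveZ (D i j) (dzE j).
  exact: is_deriveM (dzE i) dZ.
have dsum := is_derive_sum (fun i => is_derive_sum (dterm i)).
apply: (is_derive_eq dsum).
have E1 : ((z t)^T *m D *m dz) 0 0 = \sum_i \sum_j z t i 0 * (D i j * dz j 0).
  rewrite -mulmxA mxE; apply: eq_bigr => i _.
  by rewrite !mxE mulr_sumr.
have E2 : ((z t)^T *m D *m dz) 0 0 = \sum_i \sum_j D i j * z t j 0 * dz i 0.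
  rewrite E1 exchange_big; apply: eq_bigr => i _; apply: eq_bigr => j _.
  by rewrite -{1}DT mxE; ring.
rewrite mulr_natl mulr2n {1}E1 E2 -big_split; apply: eq_bigr => i _.
by rewrite -big_split.
Qed.

(** * Exponential decay of the residual *)

(** Gronwall: [expR (k t) * W t] is nonincreasing. *)
Lemma derive_le_exp_decay (R : realType) (t1 k : R) (W dW : R -> R) :
  (forall t, t1 <= t -> is_derive t 1 W (dW t)) ->
  (forall t, t1 <= t -> dW t <= - k * W t) ->
  forall t, t1 <= t -> W t <= expR (k * t1) * W t1 * expR (- (k * t)).
Proof.
move=> dWE Wle t t1t; pose h (s : R) : R := expR (k * s) * W s.
have dh s : t1 <= s -> is_derive s 1 h (expR (k * s) * (dW s + k * W s)).
  move=> t1s; have := is_deriveM (is_derive_expRM k s) (dWE s t1s).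
  move/is_derive_eq; apply; rewrite /GRing.scale/=; ring.
have : h t <= h t1.
  have dht s : s \in `]t1, t[ -> derivable h s 1 /\ derive1 h s <= 0.
    rewrite in_itv/= => /andP[/ltW t1s _]; have dhs := dh s t1s.
    split; first by have [] := dhs.
    rewrite derive1E derive_val pmulr_rle0 ?expR_gt0//.
    by have := Wle s t1s; rewrite mulNr; lra.
  apply: (@ler0_derive1_le_cc _ h t1 t).
  - by move=> s /dht[].
  - by move=> s /dht[].
  - apply: derivable_within_continuous => s; rewrite in_itv/= => /andP[t1s _].
    by have [] := dh s t1s.
  - by rewrite in_itv/= t1t lexx.
  - by rewrite in_itv/= t1t lexx.
  - by [].
rewrite /h -/(h t1) expRN ler_pdivlMr ?expR_gt0//.
by rewrite mulrC.
Qed.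

Lemma sqr_le_exp_cvg0 (R : realType) (f : R -> R) (t1 C k : R) :
  0 < k -> (forall t, t1 <= t -> f t ^+ 2 <= C * expR (- (k * t))) ->
  f t @[t --> +oo] --> 0.
Proof.
move=> k0 hf; apply/cvgrPdist_lt => e e0.
have kt : (k * t : R) @[t --> +oo] --> +oo.
  by apply: gt0_cvgMry => //; exact: cvg_id.
have h0 : C * expR (- (k * t)) @[t --> +oo] --> C * 0.
  apply: cvgM; first exact: cvg_cst.
  apply: (@cvg_comp _ _ _ ( *%R k) (fun y => expR (- y)) _ _ _ kt).
  exact: cvgr_expR.
rewrite mulr0 in h0.
near=> t.
rewrite sub0r normrN -(@ltr_pXn2r _ 2%N)// ?nnegrE// ?(ltW e0)//.
rewrite real_normK ?num_real//.
apply: (le_lt_trans (hf t _)); first by near: t; apply: nbhs_pinfty_ge; exact: num_real.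
near: t; move: h0 => /cvgr_lt; apply; exact: exprn_gt0.
Unshelve. all: by end_near. Qed.

(** [D] may be singular, so [theta] itself need not tend to 0; its image under
    [D] does, because a generalised inverse of [D] bounds the Lyapunov function
    [theta^T D theta] by the residual [|D theta|^2] alone. *)
Lemma gradient_flow_residual_cvg0 (R : realType) (k : nat) (G D : 'M[R]_k)
    (theta : R -> 'cV[R]_k) (t0 : R) :
  sym_posdef G -> D^T = D ->
  (forall v : 'cV[R]_k, 0 <= (v^T *m D *m v) 0 0) ->
  (forall t i, t0 < t ->
    is_derive t 1 (fun s => theta s i 0 : R)
      ((- (G *m (D *m theta t)) : 'cV_k) i 0)) ->
  forall i, (D *m theta t) i 0 @[t --> +oo] --> 0.
Proof.
move=> Gpos DT D0 dtheta i.
have [c c0 hc] := posdef_coercive Gpos.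
have [L L0 hL] := psd_image_bound DT D0.
pose P := moore_penrose D.
have [DPD _ _ _] := moore_penroseP D.
have [K K0 hK] := quad_bound P.
pose W t : R := ((theta t)^T *m D *m theta t) 0 0.
pose e t := D *m theta t.
have WP t : W t = ((e t)^T *m P *m e t) 0 0.
  by rewrite /W -{1}DPD /e trmx_mul DT !mulmxA.
have dW t : t0 < t -> is_derive t 1 W (- (2 * ((e t)^T *m G *m e t) 0 0)).
  move=> t0t; have := is_derive_quad DT (fun i => dtheta t i t0t).
  move/is_derive_eq; apply.
  by rewrite mulmxN /e trmx_mul DT !mulmxA mxE mulrN.
have Wle t : - (2 * ((e t)^T *m G *m e t) 0 0) <= - (2 * c / K) * W t.
  have WK : W t / K <= ((e t)^T *m e t) 0 0.
    by rewrite ler_pdivrMr// mulrC WP.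
  have := hc (e t); have : c * (W t / K) <= c * ((e t)^T *m e t) 0 0.
    by rewrite ler_pM2l.
  rewrite (_ : - (2 * c / K) * W t = - 2 * (c * (W t / K))); last by ring.
  lra.
have t01 t : t0 + 1 <= t -> t0 < t by move=> ?; lra.
(* The derivatives are only known after [t0], so the decay starts at [t0 + 1]. *)
have decay := @derive_le_exp_decay R (t0 + 1) (2 * c / K) W _
  (fun t h => dW t (t01 t h)) (fun t _ => Wle t).
apply: (@sqr_le_exp_cvg0 _ _ (t0 + 1)
  (L * (expR (2 * c / K * (t0 + 1)) * W (t0 + 1))) (2 * c / K)) => [|t t1t].
  by rewrite divr_gt0 ?mulr_gt0.
apply: (@le_trans _ _ (((e t)^T *m e t) 0 0)).
  rewrite [leRHS]mxE (bigD1 i)//= [(e t)^T _ _]mxE -expr2 lerDl.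
  by apply: sumr_ge0 => j _; rewrite mxE -expr2 sqr_ge0.
apply: (le_trans (hL _)); rewrite -[leRHS]mulrA ler_pM2l//; exact: decay.
Qed.

(** * Entrywise limits of matrices *)

Lemma cvg_mulmx_entries (R : realType) (T : Type) (F : set_system T)
    {FF : Filter F} (a b c : nat) (A : 'M[R]_(a, b)) (z : T -> 'M[R]_(b, c))
    (l : 'M[R]_(b, c)) :
  (forall i j, z t i j @[t --> F] --> l i j) ->
  forall i j, (A *m z t) i j @[t --> F] --> (A *m l) i j.
Proof.
move=> zl i j; rewrite mxE.
rewrite (_ : (fun t => _) = (fun t => \sum_k A i k * z t k j)); last first.
  by apply/funext => t; rewrite mxE.
apply: cvg_big => [|k _]; first exact: add_continuous.
apply: cvgM; [exact: cvg_cst|exact: zl].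
Qed.

Lemma cvg_mx_entries (R : realType) (T : Type) (F : set_system T)
    {FF : Filter F} (a b : nat) (z : T -> 'M[R]_(a, b)) (l : 'M[R]_(a, b)) :
  (forall i j, z t i j @[t --> F] --> l i j) -> z t @[t --> F] --> l.
Proof.
move=> zl; apply/cvg_ballP => e e0.
have H : \forall t \near F, forall i j, ball (l i j) e (z t i j).
  apply: filter_forall => i; apply: filter_forall => j.
  by have /cvg_ballP/(_ e e0) := zl i j.
by near=> t; split => //; near: t.
Unshelve. all: by end_near. Qed.

(** * Data matrices and the matching error *)

Lemma gram_psd (R : realType) (a l : nat) (Z : 'M[R]_(a, l)) (v : 'cV[R]_a) :
  0 <= (v^T *m (Z *m Z^T) *m v) 0 0.
Proof.
have -> : v^T *m (Z *m Z^T) *m v = (Z^T *m v)^T *m (Z^T *m v).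
  by rewrite trmx_mul trmxK !mulmxA.
rewrite mxE; apply: sumr_ge0 => i _.
by rewrite [(_ *m _)^T _ _]mxE -expr2 sqr_ge0.
Qed.

(** [D^+ D] is the orthogonal projector on the row space of [D = c Z Z^T],
    which is the row space of [Z^T]. *)
Lemma moore_penrose_gram (R : realType) (a l : nat) (c : R) (Z : 'M[R]_(a, l)) :
  c != 0 -> let D := c *: (Z *m Z^T) in Z^T *m moore_penrose D *m D = Z^T.
Proof.
move=> c0 D; have [DPD _ _ _] := moore_penroseP D.
pose Y := Z^T - Z^T *m moore_penrose D *m D.
have ZY : Z *m Y = 0.
  apply: (scalerI c0); rewrite scaler0 /Y mulmxBr scalerBr !mulmxA.
  by rewrite -[_ *m D]mulmxA [c *: (_ *m (_ *m D))]scalemxAl -/D mulmxA DPD subrr.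
suff /eqP : Y = 0 by rewrite subr_eq0 eq_sym => /eqP.
rewrite -[Y]trmxK; suff -> : Y^T = 0 by rewrite trmx0.
have YE : Y = Z^T *m (1%:M - moore_penrose D *m D).
  by rewrite mulmxBr mulmx1 mulmxA.
apply: mulmx_tr_eq0.
by rewrite trmxK {1}YE trmx_mul trmxK -mulmxA ZY mulmx0.
Qed.

(** The product [Bs U] is eliminated through the data relation, which leaves the
    unknown [As] and the noise [W].  [As] multiplies only the adaptation
    residual [D Psi - R], and the noise contributes the bias [WD R]. *)
Lemma gain_error (R : realType) (n m q p l : nat)
    (As Am : 'M[R]_n) (Bs : 'M[R]_(n, m)) (Es : 'M[R]_(n, q))
    (Bm : 'M[R]_(n, p)) (X XD : 'M[R]_(n, l)) (U : 'M[R]_(m, l))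
    (W : 'M[R]_(q, l)) (c : R) (Psi : 'M[R]_(n + n, n + p)) :
  c != 0 -> XD = As *m X + Bs *m U + Es *m W ->
  let Z := col_mx X XD in
  let D := c *: (Z *m Z^T) in
  let K := c *: (U *m Z^T) *m Psi in
  let WD := c *: (Es *m W *m Z^T) *m moore_penrose D in
  row_mx (Am - As - Bs *m lsubmx K) (Bm - Bs *m rsubmx K) =
  WD *m ref_mx Am Bm +
    (WD - row_mx (- As) 1%:M) *m (D *m Psi - ref_mx Am Bm).
Proof.
move=> c0 XDE Z D K WD.
have WDD : WD *m D = c *: (Es *m W *m Z^T).
  by rewrite /WD -!scalemxAl -mulmxA -[_ *m Z^T *m _]mulmxA mulmxA
    -(mulmxA (Es *m W)) [Z^T *m (_ *m _)]mulmxA moore_penrose_gram.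
have BK : Bs *m K = row_mx (- As) 1%:M *m (D *m Psi) - WD *m (D *m Psi).
  rewrite /K !mulmxA WDD -mulmxBl; congr (_ *m _).
  rewrite /D -!scalemxAr -scalerBr; congr (_ *: _).
  rewrite !mulmxA -mulmxBl; congr (_ *m _).
  rewrite /Z mul_row_col mul1mx mulNmx XDE.
  by apply/matrixP => i j; rewrite !mxE; ring.
have -> : row_mx (Am - As - Bs *m lsubmx K) (Bm - Bs *m rsubmx K) =
    row_mx (- As) 1%:M *m ref_mx Am Bm - Bs *m K.
  rewrite -{3}[K]hsubmxK mul_mx_row opp_row_mx /ref_mx mul_row_block add_row_mx.
  by rewrite mulmx1 mulmx0 add0r !mul1mx [- As + _]addrC.
rewrite BK mulmxBl !mulmxBr; apply/matrixP => i j; rewrite !mxE; ring.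
Qed.

(** * Sampled data *)

Lemma samples_mul_tr (R : realType) (a b N : nat) (y : R -> 'cV[R]_a)
    (z : R -> 'cV[R]_b) (tau : 'I_N -> R) :
  samples y tau *m (samples z tau)^T = \sum_k y (tau k) *m (z (tau k))^T.
Proof.
apply/matrixP => i j; rewrite mxE summxE; apply: eq_bigr => k _.
by rewrite !mxE big_ord1 !mxE.
Qed.

Lemma samples_col (R : realType) (a b N : nat) (y : R -> 'cV[R]_a)
    (z : R -> 'cV[R]_b) (tau : 'I_N -> R) :
  col_mx (samples y tau) (samples z tau) =
  samples (fun t => col_mx (y t) (z t)) tau.
Proof.
apply/matrixP => i j; rewrite !mxE.
by case: splitP => k _; rewrite !mxE.
Qed.

Lemma samples_plant (R : realType) (n m q N : nat)
    (As : 'M[R]_n) (Bs : 'M[R]_(n, m)) (Es : 'M[R]_(n, q))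
    (x xd : R -> 'cV[R]_n) (u : R -> 'cV[R]_m) (w : R -> 'cV[R]_q)
    (tau : 'I_N -> R) :
  (forall k, xd (tau k) =
    As *m x (tau k) + Bs *m u (tau k) + Es *m w (tau k)) ->
  samples xd tau =
  As *m samples x tau + Bs *m samples u tau + Es *m samples w tau.
Proof.
move=> xdE; apply/matrixP => i k; rewrite !mxE xdE !mxE.
by congr (_ + _ + _); apply: eq_bigr => l _; rewrite mxE.
Qed.

Lemma gram_row_samples (R : realType) (a b N M : nat) (Y : 'M[R]_(a, N))
    (Z : 'M[R]_(b, N)) (y : R -> 'cV[R]_a) (z : R -> 'cV[R]_b)
    (tau : 'I_M -> R) :
  row_mx Y (samples y tau) *m (row_mx Z (samples z tau))^T =
  Y *m Z^T + \sum_k y (tau k) *m (z (tau k))^T.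
Proof. by rewrite tr_row_mx mul_row_col samples_mul_tr. Qed.

(** The recursive weights [(N + j - 1) / (N + j)] are those that turn the
    average of [N + j - 1] terms into a sum over [N + j]. *)
Lemma piecewise_average_at (R : realType) (a b N M : nat) (ts : nat -> R)
    (S0 : 'M[R]_(a, b)) (S : nat -> 'M[R]_(a, b)) (F : R -> 'M[R]_(a, b)) :
  (0 < N)%N -> (0 < M)%N -> ts 0%N = 0 ->
  (forall j, (j < M)%N -> ts j < ts j.+1) ->
  piecewise_average N M ts S0 S F ->
  forall j, (j <= M)%N ->
    F (ts j) = (N + j)%:R^-1 *: (S0 + \sum_(k < j) S k.+1).
Proof.
move=> N0 M0 ts0 tsS [F0 FS]; elim=> [_|j IHj jM].
  by rewrite big_ord0 addr0 addn0 F0// ts0 lexx -ts0 tsS.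
rewrite (FS j.+1)// => [|/tsS//].
rewrite !subn1 addnS/= IHj 1?ltnW// scalerA mulrAC divff.
  by rewrite mul1r -scalerDr big_ord_recr addrA.
by rewrite pnatr_eq0 -lt0n addn_gt0 N0.
Qed.

Lemma piecewise_average_last (R : realType) (a b N M : nat) (ts : nat -> R)
    (S0 : 'M[R]_(a, b)) (S : nat -> 'M[R]_(a, b)) (F : R -> 'M[R]_(a, b)) :
  (0 < M)%N -> piecewise_average N M ts S0 S F ->
  forall t, ts M <= t -> F t = F (ts M).
Proof.
move=> M0 [_ FS] t tMt.
by rewrite (FS M t) ?(FS M (ts M)) ?M0 ?leqnn ?ltnn.
Qed.

(** * Adaptive law and limit of the gains *)

Lemma im_mx_factor (R : realType) (a b c : nat) (A : 'M[R]_(a, c))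
    (B : 'M[R]_(a, b)) :
  im_mx A `<=` im_mx B -> exists Q, A = B *m Q.
Proof.
move=> AB.
have /choice[v vE] (j : 'I_c) : exists v : 'cV[R]_b, B *m v = col j A.
  have [v _ vE] : im_mx B (col j A).
    by apply: AB; exists (delta_mx j 0) => //; rewrite colE.
  by exists v.
exists (\matrix_(i, j) v j i 0); apply/matrixP => i j.
have /matrixP/(_ i 0) := vE j; rewrite !mxE => <-.
by apply: eq_bigr => l _; rewrite mxE.
Qed.

(** After [t0] the adaptation matrix is frozen, so the right-hand side is
    continuous there and each column of [Psi - Q] is a classical solution of
    the gradient flow. *)
Lemma adaptive_law_cvg (R : realType) (k p : nat) (G D : 'M[R]_k)
    (Q : 'M[R]_(k, p)) (calD : R -> 'M[R]_k) (Psi : R -> 'M[R]_(k, p))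
    (t0 : R) :
  sym_posdef G -> D^T = D ->
  (forall v : 'cV[R]_k, 0 <= (v^T *m D *m v) 0 0) ->
  0 <= t0 -> (forall t, t0 <= t -> calD t = D) ->
  ode_on `[0, +oo[ Psi (fun t => - (G *m (calD t *m Psi t - D *m Q))) ->
  forall i j, (D *m Psi t - D *m Q) i j @[t --> +oo] --> 0.
Proof.
move=> Gpos DT D0 t00 calDE hPsi i j.
have Icc (t : R) : `[0, t] `<=` `[0, +oo[.
  by move=> s /=; rewrite !in_itv/= andbT => /andP[].
have dPsi t l : t0 < t -> is_derive t 1 (fun s => Psi s l j : R)
    ((- (G *m (D *m (Psi t - Q)))) l j).
  move=> t0t; have tp : 0 < t by exact: le_lt_trans t0t.
  have tI : t \in `]0, (t + 1)[ by rewrite in_itv/= tp ltrDl ltr01.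
  have cPsi l' j' : {for t, continuous (fun s => Psi s l' j')}.
    have t1 : 0 < t + 1 by rewrite addr_gt0.
    apply: within_continuous_continuous tI => //.
    exact: ode_on_continuous (Icc _) (ltW t1) hPsi.
  have := @ode_on_derive _ _ _ _ _ _ t (t + 1) l j (Icc _) tI hPsi.
  rewrite (calDE t (ltW t0t)) -mulmxBr; apply.
  have cf : (- (G *m D) *m (Psi s - Q)) l j @[s --> t] -->
      (- (G *m D) *m (Psi t - Q)) l j.
    apply: cvg_mulmx_entries => l' j'.
    rewrite !mxE (_ : (fun s => _) = (fun s => Psi s l' j' - Q l' j')).
      by apply: cvgB; [exact: cPsi|exact: cvg_cst].
    by apply/funext => s; rewrite !mxE.
  have fE s : t0 <= s -> - (G *m (calD s *m Psi s - D *m Q)) =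
      - (G *m D) *m (Psi s - Q).
    by move=> t0s; rewrite calDE// -mulmxBr mulmxA mulNmx.
  rewrite /prop_for /continuous_at (fE t (ltW t0t)).
  apply: cvg_trans cf; apply: near_eq_cvg; near=> s.
  rewrite fE//; apply: ltW.
  by near: s; exact: lt_nbhsr.
have colM (A : 'M[R]_k) (B : 'M[R]_(k, p)) : col j (A *m B) = A *m col j B.
  by rewrite !colE mulmxA.
have := @gradient_flow_residual_cvg0 _ _ G D
  (fun t => col j (Psi t - Q)) t0 Gpos DT D0.
move=> /(_ _ i).
rewrite (_ : (fun t => _) = (fun t => (D *m Psi t - D *m Q) i j)); last first.
  by apply/funext => t; rewrite -mulmxBr -colM [LHS]mxE.
apply => t l t0t.
have := is_deriveB (dPsi t l t0t) (is_derive_cst (Q l j) t (1 : R)).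
rewrite subr0 (_ : (_ - _) = (fun s => col j (Psi s - Q) l 0)); last first.
  by apply/funext => s; rewrite !mxE.
by rewrite -!colM -[- col j _]linearN [col j _ l 0]mxE.
Unshelve. all: by end_near. Qed.

Theorem theorem1 (R : realType) (n m q p : nat) (hpm : (p <= m)%N)
  (* plant and reference model *)
  (As : 'M[R]_n) (Bs : 'M[R]_(n, m)) (Es : 'M[R]_(n, q))
  (Am : 'M[R]_n) (Bm : 'M[R]_(n, p))
  (hAm : hurwitz Am) (hctrl : controllable Am Bm)
  (rho : R) (hrho : 0 < rho)
  (* offline trajectory, its filters, and sampling times *)
  (T : R) (N : nat) (hN : (0 < N)%N)
  (x' : R -> 'cV[R]_n) (u' : R -> 'cV[R]_m) (w' : R -> 'cV[R]_q)
  (xf' : R -> 'cV[R]_n) (uf' : R -> 'cV[R]_m) (wf' : R -> 'cV[R]_q)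
  (hoff : plant_trajectory `[0, T] As Bs Es x' u' w')
  (hxf' : filtered `[0, T] rho x' xf')
  (huf' : filtered `[0, T] rho u' uf')
  (hwf' : filtered `[0, T] rho w' wf')
  (tau : 'I_N -> R)
  (htau : forall k l : 'I_N, (k < l)%N -> tau k < tau l)
  (htauT : forall k : 'I_N, 0 < tau k <= T)
  (* online trajectory, its filters, and sampling times *)
  (M : nat) (hM : (1 <= M)%N)
  (ts : nat -> R) (hts0 : ts 0%N = 0)
  (hts : forall j, (j < M)%N -> ts j < ts j.+1)
  (x : R -> 'cV[R]_n) (u : R -> 'cV[R]_m) (w : R -> 'cV[R]_q)
  (xf : R -> 'cV[R]_n) (uf : R -> 'cV[R]_m) (wf : R -> 'cV[R]_q)
  (hon : plant_trajectory `[0, +oo[ As Bs Es x u w)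
  (hxf : filtered `[0, +oo[ rho x xf)
  (huf : filtered `[0, +oo[ rho u uf)
  (hwf : filtered `[0, +oo[ rho w wf)
  (* reference trajectory *)
  (r : R -> 'cV[R]_p) (xm : R -> 'cV[R]_n)
  (hxm : ode_on `[0, +oo[ xm (fun t => Am *m xm t + Bm *m r t))
  (* data-driven piecewise constant signals *)
  (calU : R -> 'M[R]_(m, n + n)) (calD : R -> 'M[R]_(n + n, n + n))
  (hcalU : piecewise_average N M ts
     (samples uf' tau *m
        (col_mx (samples xf' tau) (samples (xdf rho x' xf') tau))^T)
     (fun j => uf (ts j) *m (col_mx (xf (ts j)) (xdf rho x xf (ts j)))^T)
     calU)
  (hcalD : piecewise_average N M ts
     (col_mx (samples xf' tau) (samples (xdf rho x' xf') tau) *m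
        (col_mx (samples xf' tau) (samples (xdf rho x' xf') tau))^T)
     (fun j => col_mx (xf (ts j)) (xdf rho x xf (ts j)) *m
        (col_mx (xf (ts j)) (xdf rho x xf (ts j)))^T)
     calD)
  (* adaptive law and control input *)
  (Gamma : 'M[R]_(n + n)) (hGamma : sym_posdef Gamma)
  (Psi : R -> 'M[R]_(n + n, n + p))
  (hPsi : ode_on `[0, +oo[ Psi
     (fun t => - (Gamma *m (calD t *m Psi t - ref_mx Am Bm))))
  (hu : forall t, 0 <= t -> u t = calU t *m Psi t *m col_mx (x t) (r t))
  (him : im_mx (ref_mx Am Bm) `<=` im_mx (calD (ts M))) :
  let Khat := fun t => lsubmx (calU t *m Psi t) in
  let Lhat := fun t => rsubmx (calU t *m Psi t) in
  let tsM := fun k : 'I_M => ts k.+1 in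
  let XM := row_mx (samples xf' tau) (samples xf tsM) in
  let XDM := row_mx (samples (xdf rho x' xf') tau)
                    (samples (xdf rho x xf) tsM) in
  let WM := row_mx (samples wf' tau) (samples wf tsM) in
  let barWM := (N + M)%:R^-1 *: (Es *m WM *m (col_mx XM XDM)^T) in
  (fun t => row_mx (Am - As - Bs *m Khat t) (Bm - Bs *m Lhat t)) @ +oo -->
    barWM *m moore_penrose (calD (ts M)) *m ref_mx Am Bm.
Proof.
move=> Khat Lhat tsM XM XDM WM barWM.
pose UM := row_mx (samples uf' tau) (samples uf tsM).
pose Z := col_mx XM XDM; pose Rm := ref_mx Am Bm.
pose c : R := (N + M)%:R^-1.
have c0 : 0 < c by rewrite invr_gt0 ltr0n addn_gt0 hN.
have Icc (t : R) : `[0, t] `<=` `[0, +oo[.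
  by move=> s /=; rewrite !in_itv/= andbT => /andP[].
have ts_ge0 j : (j <= M)%N -> 0 <= ts j.
  elim: j => [_|j IHj jM]; first by rewrite hts0.
  by rewrite (le_trans (IHj (ltnW jM)))// ltW// hts.
have XDE : XDM = As *m XM + Bs *m UM + Es *m WM.
  rewrite /XDM /XM /UM /WM !mul_mx_row !add_row_mx; congr row_mx.
    apply: samples_plant => k; have /andP[tau0 tauT] := htauT k.
    apply: (filtered_data _ (ltW tau0) hoff.1 hxf' huf' hwf').
    by move=> s /=; rewrite !in_itv/= => /andP[-> /le_trans ->].
  apply: samples_plant => k.
  exact: (filtered_data (Icc _) (ts_ge0 _ (ltn_ord k)) hon.1 hxf huf hwf).
have ZE : Z = row_mx (col_mx (samples xf' tau) (samples (xdf rho x' xf') tau))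
    (samples (fun t => col_mx (xf t) (xdf rho x xf t)) tsM).
  by rewrite /Z /XM /XDM -samples_col -block_mxEh -block_mxEv.
pose D := calD (ts M).
have DE : D = c *: (Z *m Z^T).
  rewrite ZE gram_row_samples.
  exact: (piecewise_average_at hN hM hts0 hts hcalD (leqnn M)).
have UE : calU (ts M) = c *: (UM *m Z^T).
  rewrite ZE gram_row_samples.
  exact: (piecewise_average_at hN hM hts0 hts hcalU (leqnn M)).
have [Q QE] := im_mx_factor him.
have DT : D^T = D by rewrite DE linearZ/= trmx_mul trmxK.
have D0 (v : 'cV[R]_(n + n)) : 0 <= (v^T *m D *m v) 0 0.
  by rewrite DE -scalemxAr -scalemxAl mxE mulr_ge0 ?(ltW c0) ?gram_psd.
have calDE := piecewise_average_last hM hcalD; rewrite -/D in calDE.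
have calUE := piecewise_average_last hM hcalU.
have hPsi' : ode_on `[0, +oo[ Psi
    (fun t => - (Gamma *m (calD t *m Psi t - D *m Q))) by rewrite -QE.
have res := adaptive_law_cvg hGamma DT D0 (ts_ge0 M (leqnn M)) calDE hPsi'.
pose WD := barWM *m moore_penrose D; pose J := row_mx (- As) 1%:M.
have errE t : ts M <= t ->
    row_mx (Am - As - Bs *m Khat t) (Bm - Bs *m Lhat t) =
    WD *m Rm + (WD - J) *m (D *m Psi t - D *m Q).
  move=> tMt; rewrite /Khat /Lhat calUE// UE.
  have := gain_error Am Bm (Psi t) (lt0r_neq0 c0) XDE.
  by rewrite /= -/Z -/c -DE -QE.
apply: cvg_mx_entries => i j.
have lim : ((WD *m Rm) i j + ((WD - J) *m (D *m Psi t - D *m Q)) i j)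
    @[t --> +oo] --> (WD *m Rm) i j + ((WD - J) *m (0 : 'M[R]_(n + n, n + p))) i j.
  apply: cvgD; first exact: cvg_cst.
  by apply: cvg_mulmx_entries => k l; rewrite mxE; exact: res.
have lim0 : ((WD - J) *m (0 : 'M[R]_(n + n, n + p))) i j = 0.
  by rewrite mulmx0 mxE.
rewrite lim0 addr0 in lim.
apply: cvg_trans lim; apply: near_eq_cvg; near=> t.
rewrite errE; first by rewrite [RHS]mxE.
by near: t; apply: nbhs_pinfty_ge; exact: num_real.
Unshelve. all: by end_near. Qed.
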